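(* Let $m(n)$ denote the size of a largest set of irreducible ordinary (complex) characters of the symmetric group $S_n$ all of which have the same degree. Then $m(n)\to\infty$ as $n\to\infty$.
   Context: The degree of a character $\chi$ is $\chi(1)$. *)

(* Defs.v *)
From mathcomp Require Import all_boot all_order all_algebra all_fingroup.
From mathcomp Require Import all_field all_character.

Set Implicit Arguments.
Unset Strict Implicit.
Unset Printing Implicit Defensive.

Definition equal_degree (gT : finGroupType) (G : {group gT})
    (A : {set Iirr G}) : bool :=
  [forall i in A, forall j in A, ('chi_i 1%g == 'chi_j 1%g)%R].

(* 'chi_ is injective on Iirr G, so a set of irreducible characters is
   given by the set of its indices. *)
Definition max_equal_degree (n : nat) : nat :=
  \max_(A : {set Iirr [set: 'S_n]} | equal_degree A) #|A|.

(* Main.v *)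
(** The irreducible characters of [S_n] are constructed by Frobenius' formula: for
    a strictly increasing sequence [X] of [k] naturals with sum
    [n + (0 + ... + (k - 1))], the coefficient of [x^X] in the Vandermonde product
    times the power sum of the cycle type of [g] is, up to sign, the value at [g] of
    an irreducible character. Its degree is [n!] divided by the product of the hook
    lengths, that is, of the differences [x - y > 0] with [x] in [X] and [y] not in
    [X].

    Encode [X] by the word [w] of its membership bits, and set
    [D_w(t) = 1 + (t - 1) \sum_(x in X) t ^ x]. Then
    [D_w(t) D_w(1/t) = 1 - (2 - t - 1/t) \sum_h (t ^ h + t ^ - h)], the sum being over
    the hook lengths [h], so that the hook lengths of [w] depend only on
    [D_w(t) D_w(1/t)]. This product does not change when a factor of [D_w] is replaced
    by its reversal, and the substitution [inflate] multiplies [D_w(t)] by either of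
    two mutually reversed polynomials in [t ^ |w|]. Iterating it [m] times with all
    choices yields [2 ^ m] words with the same hook lengths; their number of hooks is
    [r + K M ^ 2], where [r] and [M] are the number of hooks and the length of the
    initial word, which is enough freedom to reach every large [n]. *)
Require Import Defs.
From mathcomp Require Import all_boot all_order all_algebra all_fingroup.
From mathcomp Require Import all_field all_character mpoly.
From mathcomp Require Import zify ring.

Set Implicit Arguments.
Unset Strict Implicit.
Unset Printing Implicit Defensive.

Import GroupScope Order.TTheory GRing.Theory Num.Theory.
Local Open Scope ring_scope.

(** * Colorings of [n] points under [S_n] *)

(** The trace of a permutation matrix counts the fixed points. *)
Lemma perm_charP (aT : finGroupType) (G : {group aT}) (T : finType)
    (to : {action aT &-> T}) (S : {set T}) : [acts G, on S | to] ->
  exists2 phi : 'CF(G), phi \is a character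
    & {in G, forall g, phi g = #|'Fix_(S | to)[g]|%:R}.
Proof.
move=> nSG; pose s (i : 'I_#|S|) := enum_val i.
have sS i : s i \in S by exact: enum_valP.
pose r g : 'M[algC]_#|S| := \matrix_(i, j) (to (s i) g == s j)%:R.
have rM : mx_repr G r.
  split=> [|g h Gg Gh]; apply/matrixP=> i j; rewrite !mxE.
    by rewrite act1 (inj_eq enum_val_inj).
  have Sig : to (s i) g \in S by rewrite (acts_act nSG).
  rewrite (bigD1 (enum_rank_in Sig (to (s i) g))) //= !mxE /s.
  rewrite enum_rankK_in // eqxx mul1r actM big1 ?addr0 // => l ne_l.
  rewrite !mxE; case: eqP => [def_l | _]; last by rewrite mul0r.
  by case/eqP: ne_l; apply: enum_val_inj; rewrite enum_rankK_in // def_l.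
exists (cfRepr (MxRepresentation rM)); first exact: cfRepr_char.
move=> g Gg; rewrite cfunE Gg /mxtrace.
rewrite (eq_bigr (fun i => (to (s i) g == s i)%:R)) => [|i _]; last by rewrite mxE.
rewrite -(big_enum_val (fun x => (to x g == x)%:R)) -natr_sum /=.
rewrite -big_mkcondr sum1_card; congr (_%:R)%R; apply: eq_card => x.
by rewrite !inE sub1set inE unfold_in.
Qed.

Section Colorings.

Variables (n : nat) (T : finType).
Implicit Types (F : {ffun 'I_n -> T}) (g : 'S_n).

(** The inverse makes this a right action: products of permutations are read from left to right. *)
Definition recolor F g : {ffun 'I_n -> T} := [ffun i => F (g^-1%g i)].

Lemma recolor_is_action : is_action setT recolor.
Proof.
apply: is_total_action => [F|F g h]; apply/ffunP=> i.
  by rewrite ffunE invg1 perm1.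
by rewrite !ffunE invMg permM.
Qed.

Canonical recolor_action := Action recolor_is_action.

Definition color_count F : {ffun T -> nat} := [ffun c => #|[set i | F i == c]|].

Lemma color_count_recolor F g : color_count (recolor F g) = color_count F.
Proof.
apply/ffunP=> c; rewrite !ffunE -[RHS](card_preimset _ (@perm_inj _ g^-1%g)).
by apply: eq_card => i; rewrite !inE ffunE.
Qed.

Lemma color_count_sum F : (\sum_c color_count F c = n)%N.
Proof.
rewrite -[RHS]card_ord -sum1_card (partition_big F xpredT) //=.
by apply: eq_bigr => c _; rewrite ffunE sum1dep_card.
Qed.

Lemma color_countP F F' :
  reflect (exists g, F' = recolor F g) (color_count F == color_count F').
Proof.
apply: (iffP eqP) => [eqFF'|[g ->]]; last by rewrite color_count_recolor.
have cntE (H : {ffun _ -> T}) c : count_mem c [tuple H i | i < n] = color_count H c.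
  rewrite ffunE count_map cardE size_filter -enumT.
  by apply: eq_count => i; rewrite !inE.
have /tuple_permP[p /val_inj def_p] : perm_eq [tuple F' i | i < n] [tuple F i | i < n].
  by apply/allP=> c _ /=; rewrite !cntE eqFF'.
exists p^-1%g; apply/ffunP=> i; rewrite ffunE invgK.
by have := congr1 (fun t => tnth t i) def_p; rewrite !tnth_mktuple.
Qed.

End Colorings.

Section Burnside.

Variables (n : nat) (T : finType).
Implicit Types (F : {ffun 'I_n -> T}) (g : 'S_n).

Lemma color_count_onto (c : {ffun T -> nat}) :
  (\sum_t c t = n)%N -> exists F, color_count F = c.
Proof.
move=> sum_c; pose s := flatten [seq nseq (c t) t | t <- enum T].
have sz_s : size s == n.
  rewrite size_flatten /shape -map_comp sumnE big_map big_enum /= -sum_c.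
  by apply/eqP; apply: eq_bigr => t _; rewrite size_nseq.
exists [ffun i => tnth (Tuple sz_s) i]; apply/ffunP=> t; rewrite ffunE.
transitivity (count_mem t (Tuple sz_s)).
  rewrite -[in RHS](map_tnth_enum (Tuple sz_s)) count_map cardE size_filter.
  by rewrite -enumT; apply: eq_count => i; rewrite !inE ffunE.
rewrite /= count_flatten -map_comp sumnE big_map big_enum /= (bigD1 t) //=.
rewrite count_nseq /= eqxx mul1n big1 ?addn0 // => u /negPf ne_ut.
by rewrite count_nseq /= ne_ut.
Qed.

(** The colorings with given color counts form one orbit, so by orbit-stabilizer each contributes n!
    divided by the size of that orbit. *)
Lemma sum_stab_color (c : {ffun T -> nat}) : (\sum_t c t = n)%N ->
  (\sum_(F : {ffun 'I_n -> T} | color_count F == c) #|[set g : 'S_n | recolor F g == F]| = n`!)%N.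
Proof.
case/color_count_onto=> F0 <-; have nS : #|[set: 'S_n]| = n`!.
  by rewrite cardsT card_Sn.
have stabE F : #|[set g : 'S_n | recolor F g == F]| = #|'C_([set: 'S_n])[F | recolor_action n T]|.
  by apply: eq_card => g; rewrite !inE sub1set inE.
pose O := orbit (recolor_action n T) [set: 'S_n] F0.
have OE F : (color_count F == color_count F0) = (F \in O).
  rewrite eq_sym; apply/color_countP/imsetP => [[g ->]|[g _ ->]]; last by exists g.
  by exists g; rewrite ?inE.
rewrite (eq_bigl (mem O)); last by move=> F; rewrite OE.
rewrite (eq_bigr (fun=> n`! %/ #|O|)%N) => [|F OF]; last first.
  have eqO : orbit (recolor_action n T) [set: 'S_n] F = O by apply/orbit_eqP.
  rewrite stabE -nS -(card_orbit_stab (recolor_action n T) [set: 'S_n]%G F) eqO.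
  by rewrite mulKn //; apply/card_gt0P; exists F.
rewrite sum_nat_const mulnC divnK //.
by rewrite -nS -(card_orbit_stab (recolor_action n T) [set: 'S_n]%G F0) dvdn_mulr.
Qed.

(** Weighted Burnside count: exchange the sums and group the colorings by color counts. The counts
    are bounded by [n] so as to range over a finite type. *)
Lemma burnside_colorings (V : nmodType) (f : {ffun T -> nat} -> V) :
  \sum_(g : 'S_n) \sum_(F : {ffun 'I_n -> T} | recolor F g == F) f (color_count F) =
  (\sum_(c : {ffun T -> 'I_n.+1} | (\sum_t c t == n)%N)
     f [ffun t => val (c t)]) *+ n`!.
Proof.
pose cc F : {ffun T -> 'I_n.+1} := [ffun t => inord (color_count F t)].
have ccE F : [ffun t => val (cc F t)] = color_count F.
  apply/ffunP=> t; rewrite !ffunE /= inordK // ltnS.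
  by rewrite -[leqRHS](card_ord n) max_card.
rewrite (exchange_big_dep xpredT) //= (partition_big cc (fun c => \sum_t c t == n)%N).
  rewrite -sumrMnl; apply: eq_bigr => c /eqP sum_c.
  rewrite -(@sum_stab_color [ffun t => val (c t)]); last first.
    by rewrite -[RHS]sum_c; apply: eq_bigr => t _; rewrite ffunE.
  rewrite -sumrMnr; apply: eq_big => [F|F /eqP <-].
    rewrite -ccE; apply/eqP/eqP=> [->//|/ffunP eq_c].
    by apply/ffunP=> t; apply: val_inj; have := eq_c t; rewrite !ffunE.
  by rewrite sumr_const ccE; congr (_ *+ _); apply: eq_card => g; rewrite inE.
move=> F _; rewrite -[X in _ == X](color_count_sum F) -ccE; apply/eqP.
by apply: eq_bigr => t _; rewrite [in RHS]ffunE.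
Qed.

End Burnside.

(** * The bialternant identity *)

Lemma mcoeffXM (k : nat) (R : nzRingType) (m a : 'X_{1..k}) (p : {mpoly R[k]}) :
  ('X_[m] * p)@_a = if (m <= a)%MM then p@_(a - m) else 0.
Proof.
rewrite -commr_mpolyX; case: ifPn => [le_ma | nle_ma].
  by rewrite -{1}(submK le_ma) addmC mcoeffMX.
apply: memN_msupp_eq0; apply: contra nle_ma => /msuppM_le/allpairsP[[b c]] /=.
by rewrite msuppX inE => -[_ /eqP-> ->]; apply: lem_addl.
Qed.

Section Bialternant.

Variables (k : nat) (R : comNzRingType).
Implicit Types (A : {set 'I_k}) (Y : 'I_k -> nat).

(** Complete homogeneous symmetric polynomial in the variables indexed by [A]. With [A] as a
    parameter, variables can be removed while the ring stays fixed. *)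
Definition csym A m : {mpoly R[k]} :=
  \sum_(a : 'X_{1..k < m.+1} |
     (mdeg a == m) && [forall i, (i \notin A) ==> (a i == 0%N)]) 'X_[a].

Lemma mcoeff_csym A m a :
  (csym A m)@_a = ((mdeg a == m) && [forall i, (i \notin A) ==> (a i == 0%N)])%:R.
Proof.
pose P (b : 'X_{1..k}) := (mdeg b == m) && [forall i, (i \notin A) ==> (b i == 0%N)].
rewrite -/(P a) raddf_sum /=; have [|nPa] := boolP (P a); last first.
  rewrite big1 // => b Pb; rewrite mcoeffX; case: eqP => // def_a.
  by case/negP: nPa; rewrite -def_a.
case/andP=> /eqP def_m Aa; have lt_am : (mdeg a < m.+1)%N by rewrite def_m.
rewrite (bigD1 (Sub a lt_am)) /= ?def_m ?eqxx //= mcoeffX eqxx big1 ?addr0 //.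
move=> b /andP[_]; rewrite -val_eqE /= mcoeffX => /negPf ne_ba.
by rewrite ne_ba.
Qed.

Lemma csym0 A : csym A 0 = 1.
Proof.
apply/mpolyP=> a; rewrite mcoeff_csym mcoeff1 mdeg_eq0; case: eqP => //= ->.
by rewrite (introT forallP) // => i; rewrite mnm0E implybT.
Qed.

Lemma csym_set0 m : csym set0 m.+1 = 0.
Proof.
apply/mpolyP=> a; rewrite mcoeff_csym mcoeff0; case: eqP => //= deg_a.
rewrite (introF forallP) // => a0; move: deg_a; rewrite mdegE big1 // => i _.
by have := a0 i; rewrite inE /= => /eqP.
Qed.

Lemma csymS A l m : l \in A ->
  csym A m.+1 = csym (A :\ l) m.+1 + csym A m * 'X_l.
Proof.
move=> Al; apply/mpolyP=> a; rewrite mcoeffD !mcoeff_csym.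
have [le_la | nle_la] := boolP (U_(l) <= a)%MM; last first.
  have a_l : a l = 0%N by apply/eqP; apply: contraNT nle_la; rewrite lep1mP.
  rewrite mulrC mcoeffXM (negPf nle_la) addr0; congr (_ && _)%:R.
  apply: eq_forallb => i; rewrite !inE.
  by have [->|//] := eqVneq i l; rewrite a_l !implybT.
rewrite mulrC mcoeffXM le_la mcoeff_csym.
have /negPf-> : ~~ [forall i, (i \notin A :\ l) ==> (a i == 0%N)].
  by apply/negP=> /forallP/(_ l); rewrite !inE eqxx /= -[_ == _]negbK -lep1mP le_la.
rewrite andbF add0r; have {1 2}<- := submK le_la; rewrite mdegD mdeg1 addn1 eqSS.
congr (_ && _)%:R; apply: eq_forallb => i; rewrite mnmDE mnm1E.
by have [<-|ne_li] := eqVneq l i; rewrite ?Al ?addn0 //.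
Qed.

Lemma csym_set1 i m : csym [set i] m = 'X_i ^+ m.
Proof.
elim: m => [|m IHm]; first by rewrite csym0.
by rewrite (@csymS _ i) ?set11 // setDv csym_set0 add0r IHm exprSr.
Qed.

(** Negative indices must give 0, whereas truncated subtraction alone would give [csym setT 0],
    which is 1. *)
Definition csym_shift m l := if (l <= m)%N then csym setT (m - l) else 0.

(** The generating series of [csym A] is the product of the 1 / (1 - X_l t) for l in [A], so each
    factor 1 - X_l t removes one variable. The series is truncated after degree [N], hence the bound
    on [j]. *)
Lemma csym_del_coef A (s : seq 'I_k) N j : uniq s -> {subset s <= A} -> (j <= N)%N ->
  ((\prod_(l <- s) (1 - 'X_l *: 'X)) * \poly_(m < N.+1) csym A m)`_j
    = csym (A :\: [set l in s]) j.
Proof.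
move=> + + le_jN; elim: s j le_jN => [|l s IHs] j le_jN /=.
  move=> _ _; rewrite big_nil mul1r coef_poly ltnS le_jN; congr csym.
  by apply/setP=> i; rewrite !inE.
case/andP=> s'l us sA; have [Al sA'] : l \in A /\ {subset s <= A}.
  by split=> [|i si]; apply: sA; rewrite inE ?eqxx ?si ?orbT.
have Bl : l \in A :\: [set x in s] by rewrite !inE s'l.
have -> : A :\: [set x in l :: s] = (A :\: [set x in s]) :\ l.
  by apply/setP=> i; rewrite !inE negb_or andbA.
rewrite big_cons -mulrA mulrBl mul1r coefB -scalerAl coefZ coefXM IHs //.
case: j le_jN => [|j] ltjN; first by rewrite mulr0 subr0 !csym0.
by rewrite /= IHs 1?ltnW // (csymS _ Bl) [_ * 'X_l]mulrC addrK.
Qed.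

Definition alternant Y : {mpoly R[k]} := \det (\matrix_(i, j) 'X_i ^+ (Y j)).

Lemma alternantE Y :
  alternant Y = \sum_(s : 'S_k) (-1) ^+ s * 'X_[[multinom Y (s i) | i < k]].
Proof.
apply: eq_bigr => s _; congr (_ * _); rewrite mpolyXE_id.
by apply: eq_bigr => i _; rewrite mxE mnmE.
Qed.

(* Up to column operations by the matrix with entries the coefficients of
   [\prod_(l != i) (1 - X_l t)], the Jacobi-Trudi matrix is [(X_i ^ Y_j)];
   taking [Y_j = j] shows that the latter has the Vandermonde determinant. *)
Lemma bialternant Y :
  \det (\matrix_(j, l < k) csym_shift (Y j) l) * alternant val = alternant Y.
Proof.
pose q (i : 'I_k) : {poly {mpoly R[k]}} :=
  \prod_(l <- enum (predC1 i)) (1 - 'X_l *: 'X).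
have size_q i : (size (q i) <= k)%N.
  have le_s (s : seq 'I_k) :
      (size (\prod_(l <- s) (1 - 'X_l *: 'X) : {poly {mpoly R[k]}})%R <= (size s).+1)%N.
    elim: s => [|l s IHs]; first by rewrite big_nil size_poly1.
    rewrite big_cons; apply: leq_trans (size_polyMleq _ _) _.
    have le2 : (size ((1 - 'X_l *: 'X)%R : {poly {mpoly R[k]}}) <= 2)%N.
      rewrite (leq_trans (size_polyD _ _)) // geq_max size_poly1 size_polyN /=.
      by rewrite (leq_trans (size_scale_leq _ _)) ?size_polyX.
    by move: (leq_add le2 IHs) => /=; case: (_ + _)%N.
  apply: leq_trans (le_s _) _; rewrite -cardE cardC1 card_ord.
  by case: k i => [[]|].
pose E : 'M_k := \matrix_(l, i) (q i)`_l.
(* Entry (j, i) is the coefficient of t^(Z j) once all variables but [X_i] are removed. *)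
have mulE Z : (\matrix_(j, l < k) csym_shift (Z j) l) *m E
    = (\matrix_(i, j) 'X_i ^+ (Z j))^T.
  apply/matrixP=> j i; rewrite !mxE -csym_set1.
  have -> : [set i] = [set: 'I_k] :\: [set l in enum (predC1 i)].
    by apply/setP=> l; rewrite !inE mem_enum !inE negbK andbT.
  rewrite -(@csym_del_coef _ _ (Z j) (Z j)) ?enum_uniq // => [|l]; last by rewrite inE.
  rewrite -/(q i) coefM.
  pose f l := csym_shift (Z j) l * (q i)`_l.
  rewrite (eq_bigr (fun l : 'I_k => f l)) => [|l _]; last by rewrite !mxE.
  rewrite [RHS](eq_bigr (fun l : 'I_(Z j).+1 => f l)) => [|l _]; last first.
    by rewrite /f /csym_shift -ltnS ltn_ord mulrC coef_poly ltnS leq_subr.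
  rewrite -(big_mkord xpredT f) -[RHS](big_mkord xpredT f).
  (* The sums run over l < k and l <= Z j; outside the common range the terms vanish, by the size of
     [q i] or by the guard in [csym_shift]. *)
  have f0 l : ~~ ((l < k) && (l < (Z j).+1))%N -> f l = 0.
    rewrite negb_and -!leqNgt /f /csym_shift => /orP[le_kl | lt_jl].
      by rewrite [_`_l]nth_default ?mulr0 // (leq_trans (size_q i)).
    by rewrite leqNgt lt_jl mul0r.
  rewrite (big_nat_widen _ _ (k + (Z j).+1)) ?leq_addr //.
  rewrite [RHS](big_nat_widen _ _ (k + (Z j).+1)) ?leq_addl //.
  rewrite big_mkcond [RHS]big_mkcond; apply: eq_bigr => l _ /=.
  by do 2!case: ifPn => //= ?; rewrite f0 // negb_and -?leqNgt; apply/orP; lia.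
(* For the exponents 0, ..., k - 1 the Jacobi-Trudi matrix is unitriangular. *)
have detE : \det E = alternant val.
  rewrite -[RHS]det_tr -mulE det_mulmx det_trig; last first.
    apply/is_trig_mxP=> i j lt_ij; rewrite mxE /csym_shift leqNgt lt_ij //.
  by rewrite big1 ?mul1r // => i _; rewrite mxE /csym_shift leqnn subnn csym0.
by rewrite -detE -det_mulmx mulE det_tr.
Qed.

End Bialternant.

(** * Frobenius' character formula *)

Lemma mcoeff_alternantM (k : nat) (R : comNzRingType) Y (p : {mpoly R[k]}) a :
  (alternant R Y * p)@_a =
    \sum_(s : 'S_k) (-1) ^+ s * ('X_[[multinom Y (s i) | i < k]] * p)@_a.
Proof.
rewrite alternantE mulr_suml raddf_sum; apply: eq_bigr => s _ /=.
by rewrite -mulrA !mulr_sign; case: ifP; rewrite ?mcoeffN.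
Qed.

Lemma mcoeff_sum_ffun (k N m : nat) (R : nzRingType) (a : 'X_{1..k}) : (m <= N)%N ->
  (\sum_(v : {ffun 'I_k -> 'I_N.+1} | (\sum_i v i == m)%N)
      'X_[R, [multinom val (v i) | i < k]])@_a = (mdeg a == m)%:R.
Proof.
move=> le_mN; rewrite raddf_sum /=; have [def_m | ne_am] := eqVneq (mdeg a) m; last first.
  rewrite big1 // => v /eqP def_m; rewrite mcoeffX; case: eqP => // def_a.
  case/eqP: ne_am; rewrite -def_a mdegE -def_m.
  by apply: eq_bigr => i _; rewrite mnmE.
have lt_aN i : (a i < N.+1)%N.
  rewrite ltnS (leq_trans _ le_mN) // -def_m mdegE (bigD1 i) //= leq_addr //.
pose v0 : {ffun 'I_k -> 'I_N.+1} := [ffun i => Ordinal (lt_aN i)].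
have def_a : [multinom val (v0 i) | i < k] = a.
  by apply/mnmP=> i; rewrite mnmE ffunE.
rewrite (bigD1 v0) /=; last first.
  by rewrite -def_m mdegE; apply/eqP/eq_bigr => i _; rewrite ffunE.
rewrite def_a mcoeffX eqxx big1 ?addr0 // => v /andP[_ ne_v].
rewrite mcoeffX; case: eqP => // def_v; case/eqP: ne_v; apply/ffunP=> i.
by apply: val_inj; rewrite /= ffunE /= -[in RHS]def_v mnmE.
Qed.

Section FrobeniusCharacters.

Variables n k : nat.
Implicit Types (X Y : 'I_k -> nat) (g : 'S_n) (a b : 'X_{1..k}).

Definition color_monom (F : {ffun 'I_n -> 'I_k}) : 'X_{1..k} :=
  [multinom color_count F i | i < k].

(* The product over the cycles of [g], of lengths [l], of the power sums [p_l]. *)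
Definition power_sum g : {mpoly algC[k]} :=
  \sum_(F : {ffun 'I_n -> 'I_k} | recolor F g == F) 'X_[color_monom F].

Lemma mcoeff_power_sum g a : (power_sum g)@_a =
  #|[set F : {ffun 'I_n -> 'I_k} | (recolor F g == F) && (color_monom F == a)]|%:R.
Proof.
rewrite raddf_sum -sum1dep_card natr_sum big_mkcondr; apply: eq_bigr => F _ /=.
by rewrite mcoeffX; case: ifP.
Qed.

(** A coefficient of [power_sum g] counts the fixed colorings with prescribed color counts: this is
    a permutation character. *)
Lemma color_char a : exists2 phi : 'CF([set: 'S_n]),
  phi \is a character & forall g, phi g = (power_sum g)@_a.
Proof.
pose S := [set F : {ffun 'I_n -> 'I_k} | color_monom F == a].
have nS : [acts [set: 'S_n], on S | recolor_action n 'I_k].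
  apply/subsetP=> g _; rewrite !inE; apply/subsetP=> F; rewrite !inE.
  by rewrite /color_monom /= color_count_recolor.
case: (perm_charP nS) => phi Cphi phiE; exists phi => // g.
rewrite phiE ?inE // mcoeff_power_sum; congr (_%:R)%R; apply: eq_card => F.
by rewrite !inE sub1set inE andbC.
Qed.

(** Expanding the alternant gives a signed sum of permutation characters, with 0 wherever an
    exponent would be negative. *)
Lemma frobenius_vchar X : exists2 chi : 'CF([set: 'S_n]), chi \in 'Z[irr [set: 'S_n]]
  & forall g, chi g = (alternant algC val * power_sum g)@_[multinom X i | i < k].
Proof.
set x := [multinom X i | i < k].
have /fin_all_exists2[phi Zphi phiE] (s : 'S_k) : exists2 phi : 'CF([set: 'S_n]),
    phi \in 'Z[irr [set: 'S_n]]
    & forall g, phi g = ('X_[[multinom val (s i) | i < k]] * power_sum g)@_x.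
  have [le_sx | nle_sx] := boolP ([multinom val (s i) | i < k] <= x)%MM.
    have [phi Cphi phiE] := color_char (x - [multinom val (s i) | i < k])%MM.
    by exists phi => [|g]; rewrite ?char_vchar // mcoeffXM le_sx phiE.
  by exists 0 => [|g]; rewrite ?rpred0 // mcoeffXM (negPf nle_sx) cfunE.
exists (\sum_(s : 'S_k) (-1) ^+ s *: phi s) => [|g].
  by apply: rpred_sum => s _; rewrite rpredZsign; apply: Zphi.
rewrite sum_cfunE mcoeff_alternantM; apply: eq_bigr => s _.
by rewrite cfunE phiE.
Qed.

(** Two colorings fixed by [g] amount to one fixed coloring whose colors are pairs; its marginal
    counts are the color counts of the two. *)
Lemma power_sum_pair g b : (power_sum g)@_b *: power_sum g =
  \sum_(H : {ffun 'I_n -> 'I_k * 'I_k} | recolor H g == H)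
     ([forall j, \sum_i color_count H (i, j) == b j]%N)%:R
       *: 'X_[[multinom (\sum_j color_count H (i, j))%N | i < k]].
Proof.
pose split (H : {ffun 'I_n -> 'I_k * 'I_k}) : {ffun 'I_n -> 'I_k} * {ffun 'I_n -> 'I_k} :=
  ([ffun i => (H i).2], [ffun i => (H i).1]).
pose pair (F : {ffun 'I_n -> 'I_k} * {ffun 'I_n -> 'I_k}) :=
  [ffun i => (F.2 i, F.1 i)] : {ffun 'I_n -> 'I_k * 'I_k}.
have splitK : cancel split pair.
  by move=> H; apply/ffunP=> i; rewrite !ffunE /= -surjective_pairing.
have pairK : cancel pair split.
  by case=> F1 F2; congr (_, _); apply/ffunP=> i; rewrite !ffunE.
have count1 H i : color_count (split H).2 i = (\sum_j color_count H (i, j))%N.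
  rewrite ffunE -sum1dep_card (partition_big (fun l => (H l).2) xpredT) //=.
  apply: eq_bigr => j _; rewrite ffunE -sum1dep_card; apply: eq_bigl => l.
  by rewrite ffunE; case: (H l).
have count2 H j : color_count (split H).1 j = (\sum_i color_count H (i, j))%N.
  rewrite ffunE -sum1dep_card (partition_big (fun l => (H l).1) xpredT) //=.
  apply: eq_bigr => i _; rewrite ffunE -sum1dep_card; apply: eq_bigl => l.
  by rewrite ffunE; case: (H l) => i' j'; rewrite andbC.
rewrite /power_sum [mcoeff b _]raddf_sum /= scaler_suml.
rewrite [LHS](eq_bigr _ (fun F _ => scaler_sumr _ _ _ _)) pair_big /=.
rewrite (reindex split) /=; last by exists pair => ? _; [apply: splitK | apply: pairK].
apply: eq_big => [H | H _].
  apply/andP/eqP=> [[/eqP fix1 /eqP fix2] | fixH].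
    apply/ffunP=> i; rewrite ffunE.
    have := congr1 (fun F : {ffun _ -> _} => F i) fix1.
    have := congr1 (fun F : {ffun _ -> _} => F i) fix2.
    by rewrite !ffunE; case: (H _) (H i) => [? ?] [? ?] /= -> ->.
  have fixHi i : H (g^-1%g i) = H i by rewrite -[in RHS]fixH ffunE.
  by split; apply/eqP/ffunP=> i; rewrite !ffunE fixHi.
rewrite mcoeffX; congr (_%:R *: 'X_[_]); last first.
  by apply/mnmP=> i; rewrite !mnmE count1.
congr nat_of_bool; apply/eqP/forallP => [def_b j | def_b].
  by rewrite -count2 -def_b mnmE.
by apply/mnmP=> j; rewrite mnmE count2; apply/eqP.
Qed.

(** Up to the factor n!, this is the Frobenius characteristic of a permutation character. Burnside
    for colorings by pairs leaves a sum over matrices with column sums [b], whose row sums give the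
    monomial; independent choice of the columns gives the product. *)
Lemma frobenius_char_perm b : mdeg b = n ->
  \sum_(g : 'S_n) (power_sum g)@_b *: power_sum g
    = (\prod_j csym algC setT (b j)) *+ n`!.
Proof.
move=> deg_b; rewrite (eq_bigr _ (fun g _ => power_sum_pair g b)).
pose f (c : {ffun 'I_k * 'I_k -> nat}) : {mpoly algC[k]} :=
  ([forall j, \sum_i c (i, j) == b j]%N)%:R
     *: 'X_[[multinom (\sum_j c (i, j))%N | i < k]].
rewrite (burnside_colorings n f); congr (_ *+ _).
have csymE m : (m <= n)%N -> csym algC setT m =
    \sum_(v : {ffun 'I_k -> 'I_n.+1} | (\sum_i v i == m)%N) 'X_[[multinom val (v i) | i < k]].
  move=> le_mn; apply/mpolyP=> a; rewrite mcoeff_sum_ffun // mcoeff_csym.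
  by rewrite [X in _ && X](introT forallP) ?andbT // => i; rewrite inE.
have -> : \prod_j csym algC setT (b j) = \prod_j
    \sum_(v : {ffun 'I_k -> 'I_n.+1} | (\sum_i v i == b j)%N) 'X_[[multinom val (v i) | i < k]].
  by apply: eq_bigr => j _; apply: csymE; rewrite -deg_b mdegE (bigD1 j) //= leq_addr.
rewrite bigA_distr_big_dep.
pose uncurry (v : {ffun 'I_k -> {ffun 'I_k -> 'I_n.+1}}) : {ffun 'I_k * 'I_k -> 'I_n.+1} :=
  [ffun ij => v ij.2 ij.1].
pose curry (c : {ffun 'I_k * 'I_k -> 'I_n.+1}) : {ffun 'I_k -> {ffun 'I_k -> 'I_n.+1}} :=
  [ffun j => [ffun i => c (i, j)]].
rewrite (reindex uncurry); last first.
  exists curry => [v _ | c _]; first by apply/ffunP=> j; apply/ffunP=> i; rewrite !ffunE.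
  by apply/ffunP=> [[i j]]; rewrite !ffunE.
rewrite big_mkcond [RHS]big_mkcond; apply: eq_bigr => v _ /=.
have sumE j : (\sum_i uncurry v (i, j) = \sum_i v j i)%N.
  by apply: eq_bigr => i _; rewrite ffunE.
rewrite /f; case: (boolP (v \in _)) => [/familyP fam_v | nfam_v].
  have def_b j : (\sum_i v j i = b j)%N by apply/eqP; apply: fam_v.
  have -> : (\sum_t uncurry v t == n)%N.
    apply/eqP; rewrite -[RHS]deg_b mdegE.
    rewrite [RHS](eq_bigr (fun j => \sum_i uncurry v (i, j)))%N => [|j _].
      by rewrite exchange_big pair_bigA /=; apply: eq_bigr => [[]].
    by rewrite sumE def_b.
  rewrite [X in (nat_of_bool X)%:R *: _](introT forallP) => [|j]; last first.
    by rewrite -def_b -sumE; apply/eqP/eq_bigr => i _; rewrite ffunE.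
  rewrite scale1r mprodXE; congr 'X_[_]; apply/mnmP=> i.
  by rewrite mnmE mnm_sumE; apply: eq_bigr => j _; rewrite !ffunE mnmE.
rewrite [X in (nat_of_bool X)%:R *: _](introF forallP) ?scale0r ?if_same // => all_b.
case/familyP: nfam_v => j; have := all_b j; rewrite unfold_in -sumE.
by under eq_bigr do rewrite ffunE.
Qed.

(** Integers are real, which lets [frobenius_dot] drop the complex conjugation. *)
Lemma mcoeff_alternant_int Y g a : (alternant algC Y * power_sum g)@_a \is a Num.int.
Proof.
rewrite mcoeff_alternantM rpred_sum // => s _; rewrite rpredMsign mcoeffXM.
by case: ifP => _; rewrite ?rpred0 // mcoeff_power_sum rpred_nat.
Qed.

(** Expanding the alternant over permutations and applying [frobenius_char_perm] to each term gives
    the expansion of the Jacobi-Trudi determinant. *)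
Lemma frobenius_char Y (psi : 'CF([set: 'S_n])) :
    (forall g, psi g = (alternant algC val * power_sum g)@_[multinom Y i | i < k]) ->
    (\sum_i Y i = n + \sum_(i < k) i)%N ->
  \sum_g psi g *: power_sum g = (\det (\matrix_(j, l < k) csym_shift k algC (Y j) l)) *+ n`!.
Proof.
move=> psiE sumY; set y := [multinom Y i | i < k] in psiE.
pose m (s : 'S_k) := [multinom val (s i) | i < k].
transitivity (\sum_(s : 'S_k) (-1) ^+ s *: \sum_g ('X_[m s] * power_sum g)@_y *: power_sum g).
  rewrite [RHS](eq_bigr _ (fun s _ => scaler_sumr _ _ _ _)) exchange_big /=.
  apply: eq_bigr => g _; rewrite psiE mcoeff_alternantM scaler_suml.
  by apply: eq_bigr => s _; rewrite scalerA.
rewrite -sumrMnl; apply: eq_bigr => s _.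
rewrite -mulrnAr scaler_sign mulr_sign.
suffices -> : \sum_g ('X_[m s] * power_sum g)@_y *: power_sum g =
    (\prod_i (\matrix_(j, l < k) csym_shift k algC (Y j) l) i (s i)) *+ n`! by [].
rewrite (eq_bigr _ (fun g _ => congr1 (fun c => c *: power_sum g) (mcoeffXM _ _ _))).
have [le_sy | nle_sy] := boolP (m s <= y)%MM; last first.
  rewrite big1 => [|g _]; last by rewrite scale0r.
  have [i lt_is] : exists i, (Y i < s i)%N.
    apply/existsP; apply: contraR nle_sy => /existsPn le_sY.
    by apply/mnm_lepP=> i; rewrite !mnmE leqNgt le_sY.
  by rewrite (bigD1 i) //= mxE /csym_shift leqNgt lt_is mul0r mul0rn.
rewrite frobenius_char_perm; last first.
  apply/eqP; rewrite -(eqn_add2r (mdeg (m s))) -mdegD submK //.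
  rewrite !mdegE (eq_bigr Y) => [|i _]; last by rewrite mnmE.
  rewrite sumY (reindex_inj (@perm_inj _ s)) /= eqn_add2l.
  by apply/eqP/eq_bigr => i _; rewrite mnmE.
congr (_ *+ _); apply: eq_bigr => i _; have/mnm_lepP/(_ i) := le_sy.
by rewrite mxE /csym_shift mnmBE !mnmE /= => ->.
Qed.

(** Summing chi(g) psi(g) extracts a coefficient of the Vandermonde alternant times the
    characteristic of [psi], and [bialternant] turns this product into [alternant Y]. *)
Lemma frobenius_dot X Y (chi psi : 'CF([set: 'S_n])) :
    (forall g, chi g = (alternant algC val * power_sum g)@_[multinom X i | i < k]) ->
    (forall g, psi g = (alternant algC val * power_sum g)@_[multinom Y i | i < k]) ->
    (\sum_i Y i = n + \sum_(i < k) i)%N ->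
  '[chi, psi] = (alternant algC Y)@_[multinom X i | i < k].
Proof.
move=> chiE psiE sumY; rewrite cfdotE -(bialternant algC Y) cardsT card_Sn.
apply: (mulfI (_ : n`!%:R != 0)); first by rewrite pnatr_eq0 -lt0n fact_gt0.
rewrite mulVKf ?pnatr_eq0 -?lt0n ?fact_gt0 // [RHS]mulr_natl -mcoeffMn -mulrnAl.
rewrite -(frobenius_char psiE sumY) mulrC mulr_sumr raddf_sum /=.
apply: eq_big => [g | g _]; first by rewrite inE.
rewrite -scalerAr mcoeffZ -chiE mulrC; congr (_ * _).
by rewrite psiE; apply/CrealP/Rreal_int/mcoeff_alternant_int.
Qed.

(** * Degrees of the Frobenius characters *)

(** Multinomial theorem without division; in the induction, splitting off a factor [X_i] contributes
    [a i] times m!. *)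
Lemma mcoeff_sumX_exp m a : mdeg a = m ->
  ((\sum_i 'X_i : {mpoly algC[k]}) ^+ m)@_a * \prod_i (a i)`!%:R = m`!%:R.
Proof.
elim: m a => [|m IHm] a deg_a.
  have /eqP := deg_a; rewrite mdeg_eq0 => /eqP->.
  by rewrite expr0 mcoeff1 eqxx mul1r big1 // => i _; rewrite mnm0E.
rewrite exprS mulr_suml raddf_sum mulr_suml /=.
rewrite (eq_bigr (fun i => (a i * m`!)%:R)) => [|i _].
  by rewrite -natr_sum -big_distrl /= -mdegE deg_a.
rewrite mcoeffXM lep1mP; have [-> | ai_gt0] := posnP (a i).
  by rewrite /= mul0r mul0n.
have le_ia : (U_(i) <= a)%MM by rewrite lep1mP -lt0n.
rewrite /= natrM -(IHm (a - U_(i))%MM); last first.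
  by apply: succn_inj; rewrite -deg_a -{2}(submK le_ia) mdegD mdeg1 addn1.
rewrite mulrCA; congr (_ * _); rewrite (bigD1 i) //= [in RHS](bigD1 i) //= mulrA.
rewrite mnmBE mnm1E eqxx subn1 -natrM -{1}(prednK ai_gt0) factS prednK //.
congr (_ * _); apply: eq_bigr => j ne_ji.
by rewrite mnmBE mnm1E eq_sym (negPf ne_ji) subn0.
Qed.

Lemma power_sum1 : power_sum 1 = (\sum_i 'X_i) ^+ n.
Proof.
rewrite -[X in _ ^+ X](card_ord n) -prodr_const bigA_distr_bigA /=.
apply: eq_big => [F | F _]; first by rewrite (act1 (recolor_action n _)) eqxx.
rewrite mprodXE; congr 'X_[_]; apply/mnmP=> i; rewrite mnmE ffunE mnm_sumE.
by rewrite -sum1dep_card big_mkcond; apply: eq_bigr => l _; rewrite mnm1E; case: eqP.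
Qed.

(** Falling factorials are monic polynomials of degree [j] in [X i], so the matrix is a Vandermonde
    matrix times a unitriangular one. *)
Lemma det_ffact (R : comNzRingType) X :
  \det (\matrix_(i, j < k) (X i ^_ j)%:R : 'M[R]_k) =
    \prod_(i < k) \prod_(j < k | (i < j)%N) ((X j)%:R - (X i)%:R).
Proof.
pose fp m : {poly R} := \prod_(l < m) ('X - l%:R%:P).
have fpE m x : (fp m).[x%:R] = (x ^_ m)%:R.
  elim: m => [|m IHm]; first by rewrite /fp big_ord0 hornerC.
  rewrite /fp big_ord_recr hornerM -/(fp m) IHm !hornerE ffactnSr natrM.
  have [le_mx | lt_xm] := leqP m x; first by rewrite natrB.
  by rewrite ffact_small // !mul0r.
have size_fp m : size (fp m) = m.+1.
  by rewrite /fp -big_enum size_prod_XsubC size_enum_ord.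
have fp_monic m : fp m \is monic by apply: monic_prod_XsubC.
pose C : 'M[R]_k := \matrix_(l, j) (fp j)`_l.
transitivity (\det ((Vandermonde k (\row_i (X i)%:R))^T *m C)).
  congr (\det _); apply/matrixP=> i j; rewrite !mxE -fpE.
  rewrite (@horner_coef_wide _ k) ?size_fp //; apply: eq_bigr => l _.
  by rewrite !mxE mulrC.
rewrite det_mulmx det_tr det_Vandermonde -[\det C]det_tr det_trig; last first.
  by apply/is_trig_mxP=> i j lt_ij; rewrite !mxE nth_default ?size_fp.
rewrite [X in _ * X]big1 ?mulr1 => [|i _]; last first.
  by rewrite !mxE -[RHS](monicP (fp_monic i)) lead_coefE size_fp.
by apply: eq_bigr => i _; apply: eq_bigr => j _; rewrite !mxE.
Qed.

(** Each permutation contributes a multinomial coefficient, which the factorials of the [X i] turn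
    into n! times a product of falling factorials, a term of [det_ffact]. *)
Lemma frobenius_degree X (chi : 'CF([set: 'S_n])) :
    (forall g, chi g = (alternant algC val * power_sum g)@_[multinom X i | i < k]) ->
    (\sum_i X i = n + \sum_(i < k) i)%N ->
  chi 1%g * \prod_i (X i)`!%:R =
    n`!%:R * \prod_(i < k) \prod_(j < k | (i < j)%N) ((X j)%:R - (X i)%:R).
Proof.
move=> chiE sumX; rewrite chiE -det_ffact mcoeff_alternantM mulr_suml mulr_sumr.
apply: eq_bigr => s _; rewrite -mulrA [RHS]mulrCA; congr (_ * _).
rewrite mcoeffXM; case: ifPn => [/mnm_lepP le_sx | nle_sx]; last first.
  have [i lt_is] : exists i, (X i < s i)%N.
    apply/existsP; apply: contraR nle_sx => /existsPn le_sX.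
    by apply/mnm_lepP=> i; rewrite !mnmE leqNgt le_sX.
  by rewrite mul0r (bigD1 i) //= mxE ffact_small // mulr0n mul0r mulr0.
have {}le_sx i : (s i <= X i)%N by have := le_sx i; rewrite !mnmE.
rewrite power_sum1 -(@mcoeff_sumX_exp n ([multinom X i | i < k] - [multinom val (s i) | i < k])%MM).
  rewrite -mulrA; congr (_ * _); rewrite -big_split /=; apply: eq_bigr => i _.
  by rewrite mxE mnmBE !mnmE -natrM mulnC ffact_fact.
apply/eqP; rewrite -(eqn_add2r (mdeg [multinom val (s i) | i < k])) -mdegD submK.
  rewrite !mdegE (eq_bigr X) => [|i _]; last by rewrite mnmE.
  rewrite sumX (reindex_inj (@perm_inj _ s)) /= eqn_add2l.
  by apply/eqP/eq_bigr => i _; rewrite mnmE.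
by apply/mnm_lepP=> i; rewrite !mnmE; apply: le_sx.
Qed.

End FrobeniusCharacters.

(** * Hook lengths of words *)

Fixpoint beta (w : bitseq) : seq nat :=
  if w is b :: w' then
    if b then 0%N :: map succn (beta w') else map succn (beta w')
  else [::].

(** Hook lengths of the partition whose boundary path is [w]: a cell is a [false] step with a later
    [true] step, and its hook length is their distance. *)
Fixpoint hooks (w : bitseq) : seq nat :=
  if w is b :: w' then
    if b then hooks w' else map succn (beta w') ++ hooks w'
  else [::].

Lemma size_beta w : size (beta w) = count id w.
Proof. by elim: w => // -[] w /= <-; rewrite size_map. Qed.

Lemma mem_beta w i : (i \in beta w) = nth false w i.
Proof.
elim: w i => [|b w IHw] [|i]; rewrite ?nth_nil //=; last first.
  by rewrite -IHw -(mem_map succn_inj); case: b.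
by case: b => //=; apply/negP=> /mapP[].
Qed.

Lemma beta_sorted w : sorted ltn (beta w).
Proof.
have mapS s : sorted ltn s -> sorted ltn (map succn s) by rewrite sorted_map.
elim: w => // b w /mapS IHw /=; case: b => //=.
by rewrite path_min_sorted //; apply/allP=> _ /mapP[i _ ->].
Qed.

(** Each x in [beta w] counts the letters before it: the [false] ones give its hooks, the [true]
    ones give 0, 1, 2, ... in turn. *)
Lemma sum_beta w :
  (\sum_(x <- beta w) x = size (hooks w) + \sum_(i < count id w) i)%N.
Proof.
elim: w => [|b w IHw] /=; first by rewrite big_nil big_ord0.
have sumS : (\sum_(x <- map succn (beta w)) x
    = \sum_(x <- beta w) x + count id w)%N.
  rewrite big_map -size_beta -sum1_size -big_split /=.
  by apply: eq_bigr => x _; rewrite addn1.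
case: b => /=; rewrite ?big_cons sumS IHw ?add1n ?big_ord_recr /= ?addnA //.
by rewrite add0n size_cat size_map size_beta addnAC [(count id w + _)%N]addnC.
Qed.

Fixpoint diff_prod (s : seq nat) : nat :=
  if s is x :: s' then (\prod_(y <- s') (y - x) * diff_prod s')%N else 1%N.

(** Among the factors x - y of x!, with y < x, those with y outside [beta w] are hook lengths and
    the others are differences in [diff_prod]. *)
Lemma hook_formula w :
  (\prod_(x <- beta w) x`! = \prod_(h <- hooks w) h * diff_prod (beta w))%N.
Proof.
have diffS s : diff_prod (map succn s) = diff_prod s.
  by elim: s => //= x s ->; rewrite big_map.
elim: w => [|b w IHw] /=; first by rewrite !big_nil.
have factS' : (\prod_(x <- map succn (beta w)) x`!
    = \prod_(x <- map succn (beta w)) x * \prod_(x <- beta w) x`!)%N.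
  by rewrite !big_map -big_split.
case: b => /=; rewrite ?big_cons factS' IHw diffS; last by rewrite big_cat mulnA.
rewrite fact0 mul1n mulnCA; congr (_ * (_ * _))%N.
by apply: eq_bigr => x _; rewrite subn0.
Qed.

Lemma diff_prodE (s : seq nat) : sorted ltn s ->
  diff_prod s = (\prod_(i < size s) \prod_(j < size s | (i < j)%N) (nth 0 s j - nth 0 s i))%N.
Proof.
elim: s => [|x s IHs] /=; first by rewrite big_ord0.
move=> /path_sorted/IHs->; rewrite big_ord_recl /=; congr (_ * _)%N.
  by rewrite [RHS]big_mkcond big_ord_recl /= mul1n (big_nth 0%N) big_mkord.
apply: eq_bigr => i _; rewrite [RHS]big_mkcond big_ord_recl /= mul1n big_mkcond.
by apply: eq_bigr.
Qed.

Lemma size_hooks_cat u v :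
  size (hooks (u ++ v)) = (size (hooks u) + size (hooks v) + count negb u * count id v)%N.
Proof.
elim: u => [|b u IHu] //=; first by rewrite addn0.
by case: b; rewrite ?IHu //= !size_cat !size_map !size_beta count_cat IHu; lia.
Qed.

(** Each pair of a [false] and a [true] letter is a hook of [u] or of its complement, according to
    their order. *)
Lemma size_hooks_negb u :
  (size (hooks (map negb u)) + size (hooks u) = count negb u * count id u)%N.
Proof.
elim: u => [|b u IHu] //=.
have cnt : count id (map negb u) = count negb u by rewrite count_map; apply: eq_count.
by case: b => /=; rewrite ?size_cat ?size_map !size_beta ?cnt; lia.
Qed.

Lemma size_hooks_nseq m b : size (hooks (nseq m b)) = 0%N.
Proof.
by elim: m => //= m IHm; case: b IHm => //= IHm; rewrite size_cat size_map size_beta IHm count_nseq.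
Qed.

Section HookGeneratingFunction.

Variable F : fieldType.
Implicit Types (t : F) (u v w : bitseq).

Definition edge_poly w t : F := 1 + (t - 1) * \sum_(x <- beta w) t ^+ x.

Lemma sum_betaS w t : \sum_(x <- map succn (beta w)) t ^+ x = t * \sum_(x <- beta w) t ^+ x.
Proof. by rewrite big_map mulr_sumr; apply: eq_bigr => x _; rewrite exprS. Qed.

(** A leading [true] multiplies [edge_poly w t] by t, which cancels in the product; a leading
    [false] changes the product exactly by the new hooks. *)
Lemma edge_poly_hooks w t : t != 0 ->
  edge_poly w t * edge_poly w t^-1 =
    1 - (2 - t - t^-1) * \sum_(h <- hooks w) (t ^+ h + t^-1 ^+ h).
Proof.
move=> t0; rewrite /edge_poly; elim: w => [|b w IHw] /=.
  by rewrite !big_nil; ring.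
set P := \sum_(x <- beta w) t ^+ x in IHw *; set P' := \sum_(x <- beta w) t^-1 ^+ x in IHw *.
set G := \sum_(h <- hooks w) _ in IHw *.
have {IHw}defG : (2 - t - t^-1) * G = 1 - (1 + (t - 1) * P) * (1 + (t^-1 - 1) * P').
  by rewrite IHw; ring.
case: b => /=.
  by rewrite !big_cons !expr0 !sum_betaS -/P -/P' -/G defG; field.
by rewrite big_cat /= -/G big_split /= !sum_betaS -/P -/P' [X in 1 - X]mulrDr defG; field.
Qed.

Lemma edge_poly_cat u v t :
  edge_poly (u ++ v) t = edge_poly u t + t ^+ size u * (edge_poly v t - 1).
Proof.
rewrite /edge_poly; elim: u => [|b u IHu] /=; first by rewrite big_nil; ring.
set Q := _ * (_ - _) in IHu; have {IHu}defQ : Q = (t - 1) *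
    (\sum_(x <- beta (u ++ v)) t ^+ x - \sum_(x <- beta u) t ^+ x).
  by rewrite -[Q](addKr (1 + (t - 1) * \sum_(x <- beta u) t ^+ x)) -IHu; ring.
by case: b; rewrite ?big_cons !sum_betaS exprS -[t * _ * _]mulrA -/Q defQ; ring.
Qed.

Lemma edge_poly_nseq m b t : edge_poly (nseq m b) t = if b then t ^+ m else 1.
Proof.
rewrite /edge_poly; elim: m => [|m IHm] /=.
  by rewrite big_nil mulr0 addr0 if_same.
case: b IHm => IHm; rewrite ?big_cons sum_betaS.
  by rewrite exprS -IHm; ring.
by rewrite mulrCA -[X in t * X](addKr 1) IHm; ring.
Qed.

Lemma edge_poly_negb u t : edge_poly (map negb u) t = 1 + t ^+ size u - edge_poly u t.
Proof.
rewrite /edge_poly; elim: u => [|b u IHu] /=; first by rewrite !big_nil; ring.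
move: IHu; set P := \sum_(x <- beta u) _; set N := \sum_(x <- beta _) _ => IHu.
have {IHu}defT : t ^+ size u = 1 + (t - 1) * (N + P).
  by apply: (addrI 1); apply: (addIr (- (1 + (t - 1) * P))); rewrite -IHu; ring.
by case: b; rewrite /= !big_cons ?big_cons !sum_betaS -/P -/N exprS defT; ring.
Qed.

End HookGeneratingFunction.

(** * Distinct words with equal hook lengths *)

(** A high power of t turns both sides into polynomials that agree at infinitely many points and
    whose coefficients determine the multiplicities. *)
Lemma perm_eq_gen (s1 s2 : seq nat) :
    (forall t : rat, t != 0 -> t != 1 ->
       \sum_(h <- s1) (t ^+ h + t^-1 ^+ h) = \sum_(h <- s2) (t ^+ h + t^-1 ^+ h)) ->
  perm_eq s1 s2.
Proof.
move=> eq_gen; pose N := \max_(h <- s1 ++ s2) h.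
pose Q s : {poly rat} := \sum_(h <- s) ('X^(N + h) + 'X^(N - h)).
have sN (s : seq nat) h : {subset s <= s1 ++ s2} -> h \in s -> (h <= N)%N.
  by move=> ss /ss s_h; apply: (@leq_bigmax_seq _ _ xpredT id).
have Qt (s : seq nat) t : t != 0 -> {subset s <= s1 ++ s2} ->
    (Q s).[t] = t ^+ N * \sum_(h <- s) (t ^+ h + t^-1 ^+ h).
  move=> t0 ss; rewrite horner_sum mulr_sumr big_seq [RHS]big_seq.
  apply: eq_bigr => h sh; rewrite !hornerE exprD mulrDr exprB ?unitfE //.
    by rewrite exprVn.
  exact: sN sh.
(* For d = 0 the two monomials coincide, which doubles the multiplicity. *)
have Qcoef (s : seq nat) d : {subset s <= s1 ++ s2} ->
    (Q s)`_(N + d) = (count_mem d s)%:R * (1 + (d == 0)%:R).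
  move=> ss; rewrite coef_sum -sum1_count natr_sum mulr_suml [RHS]big_mkcond.
  rewrite [LHS]big_seq [RHS]big_seq; apply: eq_bigr => h sh /=.
  rewrite coefD !coefXn; have le_hN := sN _ _ ss sh.
  have -> : (N + d == N - h)%N = (h == 0%N) && (d == 0%N) by lia.
  have -> : (N + d == N + h)%N = (h == d) by lia.
  have [-> | ne_hd] := eqVneq h d; first by rewrite mul1r andbb.
  rewrite add0r; have [h0 | //] := eqVneq h 0%N.
  by rewrite h0 eq_sym in ne_hd; rewrite (negPf ne_hd).
have s1s : {subset s1 <= s1 ++ s2} by move=> h; rewrite mem_cat => ->.
have s2s : {subset s2 <= s1 ++ s2} by move=> h; rewrite mem_cat orbC => ->.
suffices eqQ : Q s1 = Q s2.
  apply/allP=> d _ /=; have := Qcoef s1 d s1s; rewrite eqQ Qcoef //.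
  move/mulIf => eq_c; rewrite -(eqr_nat rat) eq_c //.
  by case: (d == 0%N).
apply/eqP; rewrite -subr_eq0; apply/negPn/negP=> nz.
(* The points 2, 3, ... avoid the excluded 0 and 1; as many as the size of the difference are one
   too many for its degree. *)
pose rs := [seq (i.+2)%:R : rat | i <- iota 0 (size (Q s1 - Q s2))].
have := max_poly_roots (rs := rs) nz; rewrite size_map size_iota ltnn.
suffices [-> ->] : all (root (Q s1 - Q s2)) rs /\ uniq rs by move/(_ isT isT).
split; last first.
  rewrite map_inj_uniq ?iota_uniq // => i j /eqP.
  by rewrite eqr_nat => /eqP[].
apply/allP=> _ /mapP[i _ ->]; rewrite rootE hornerD hornerN subr_eq0.
by rewrite !Qt ?pnatr_eq0 // eq_gen ?pnatr_eq0 // -[1]/(1%:R) eqr_nat.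
Qed.

(* Writing [edge_poly w] as [D] and [T = t ^ |w|], both words have an edge
   polynomial divisible by [D], with cofactor [T - T^3 + T^4] for [b = false]
   and its reversal [1 - T + T^3] for [b = true]; hence the same hooks. *)
Definition inflate (b : bool) (w : bitseq) : bitseq :=
  if b then w ++ map negb w ++ nseq (size w) true ++ w ++ nseq (size w) false
  else nseq (size w) true ++ w ++ nseq (size w) false ++ map negb w ++ w.

Lemma size_inflate b w : size (inflate b w) = (5 * size w)%N.
Proof. by rewrite /inflate; case: b; rewrite !size_cat !size_map !size_nseq; lia. Qed.

Lemma count_inflate b w : count id (inflate b w) = (2 * size w + count id w)%N.
Proof.
have cw : size w = (count id w + count negb w)%N by rewrite -(count_predC id w).
have c1 : count id (map negb w) = count negb w by rewrite count_map; apply: eq_count.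
by rewrite /inflate; case: b; rewrite !count_cat !count_nseq c1 cw /=; lia.
Qed.

(** Inside the blocks, the two copies of [w] and its complement have the hooks of [w] plus one per
    pair of a [false] and a [true] letter; pairs across blocks complete the count. *)
Lemma size_hooks_inflate b w :
  size (hooks (inflate b w)) = (size (hooks w) + 2 * size w ^ 2)%N.
Proof.
have cw := count_predC id w; have hw := size_hooks_negb w.
have c1 : count id (map negb w) = count negb w by rewrite count_map; apply: eq_count.
have c2 : count negb (map negb w) = count id w.
  by rewrite count_map; apply: eq_count => x; apply: negbK.
have {}cw : size w = (count id w + count negb w)%N by rewrite -cw.
rewrite /inflate; case: b; rewrite !size_hooks_cat !size_hooks_nseq !count_cat !count_nseq /=;
by rewrite c1 ?c2 cw; nia.
Qed.

Lemma perm_hooks_inflate b b' w w' : size w = size w' -> perm_eq (hooks w) (hooks w') ->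
  perm_eq (hooks (inflate b w)) (hooks (inflate b' w')).
Proof.
move=> eq_sz eq_hk; apply: perm_eq_gen => t t0 t1.
pose f c T : rat := if c then 1 - T + T ^+ 3 else T - T ^+ 3 + T ^+ 4.
have edgeE c v x : edge_poly (inflate c v) x = f c (x ^+ size v) * edge_poly v x.
  rewrite /inflate; case: c; rewrite !edge_poly_cat !edge_poly_nseq !edge_poly_negb;
  by rewrite ?size_map !size_nseq /f; ring.
have c0 : 2 - t - t^-1 != 0.
  have -> : 2 - t - t^-1 = - ((t - 1) ^+ 2 / t) by field.
  by rewrite oppr_eq0 mulf_neq0 ?invr_eq0 // expf_neq0 // subr_eq0.
suffices: edge_poly (inflate b w) t * edge_poly (inflate b w) t^-1 =
    edge_poly (inflate b' w') t * edge_poly (inflate b' w') t^-1.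
  by rewrite !edge_poly_hooks // => /addrI/oppr_inj/(mulfI c0).
rewrite !edgeE mulrACA [RHS]mulrACA edge_poly_hooks // edge_poly_hooks //.
rewrite (perm_big _ eq_hk) eq_sz exprVn; congr (_ * _).
have T0 : t ^+ size w' != 0 by rewrite expf_neq0.
(* [f true T] is T^4 times [f false] at 1 / T, so both choices give the same product of values at T
   and 1 / T. *)
by rewrite /f; case: b; case: b'; field.
Qed.

(** The word [inflate b w] starts with [w] or with as many letters [true]; a [false] in [w] tells
    the cases apart. *)
Lemma inflate_inj b b' w w' : size w = size w' -> false \in w -> false \in w' ->
  inflate b w = inflate b' w' -> b = b' /\ w = w'.
Proof.
move=> eq_sz wf wf'; rewrite /inflate; case: b; case: b' => /eqP;
rewrite eqseq_cat ?size_nseq // => /andP[/eqP eq_hd].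
- by [].
- by rewrite eq_hd mem_nseq andbF in wf.
- by rewrite -eq_hd mem_nseq andbF in wf'.
by rewrite eqseq_cat // => /andP[/eqP->].
Qed.

Fixpoint tower (w : bitseq) (bs : seq bool) : bitseq :=
  if bs is b :: bs' then inflate b (tower w bs') else w.

Lemma size_tower w bs : size (tower w bs) = (5 ^ size bs * size w)%N.
Proof. by elim: bs => [|b bs IH] /=; rewrite ?mul1n // size_inflate IH expnS mulnA. Qed.

Lemma count_tower w bs bs' : size bs = size bs' ->
  count id (tower w bs) = count id (tower w bs').
Proof.
elim: bs bs' => [|b bs IH] [|b' bs'] //= [eq_sz].
by rewrite !count_inflate !size_tower eq_sz (IH bs').
Qed.

Lemma perm_hooks_tower w bs bs' : size bs = size bs' ->
  perm_eq (hooks (tower w bs)) (hooks (tower w bs')).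
Proof.
elim: bs bs' => [|b bs IH] [|b' bs'] //= [eq_sz].
by apply: perm_hooks_inflate; rewrite ?size_tower ?eq_sz ?IH.
Qed.

(** The inflation at level [i] acts on a word of length 5^i |w| and so adds 2 * 25^i * |w|^2
    hooks. *)
Lemma size_hooks_tower w bs : size (hooks (tower w bs)) =
  (size (hooks w) + size w ^ 2 * \sum_(i < size bs) 2 * 25 ^ i)%N.
Proof.
elim: bs => [|b bs IH] /=; first by rewrite big_ord0 muln0 addn0.
rewrite size_hooks_inflate IH size_tower big_ord_recr /= mulnDr addnA.
have -> : (25 ^ size bs = (5 ^ size bs) ^ 2)%N by rewrite -expnM mulnC expnM.
by rewrite -!mulnn; lia.
Qed.

Lemma tower_inj w bs bs' : false \in w -> size bs = size bs' ->
  tower w bs = tower w bs' -> bs = bs'.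
Proof.
move=> wf; have tf cs : false \in tower w cs.
  by elim: cs => //= b cs IH; rewrite /inflate; case: b; rewrite !mem_cat IH ?orbT.
elim: bs bs' => [|b bs IH] [|b' bs'] //= [eq_sz].
by case/inflate_inj=> [|||-> /IH->]; rewrite ?size_tower ?eq_sz.
Qed.

(* The word of the partition of [r] with [r %/ B] parts [B] and one part [r %% B]. *)
Lemma word_with_hooks B M r : (0 < B)%N -> (B + 1 + r %/ B <= M)%N ->
  exists w, [/\ size w = M, false \in w & size (hooks w) = r].
Proof.
move=> B0 le_M; have lt_B := ltn_pmod r B0.
(* The first [true] has r mod B letters [false] before it, each later one has [B]; the final [false]
   letters pad the length without adding hooks. *)
exists (nseq (r %% B) false ++ true :: nseq (B - r %% B) false ++
        nseq (r %/ B) true ++ nseq (M - (B + 1 + r %/ B)) false); split.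
- by rewrite !size_cat /= !size_cat !size_nseq; lia.
- rewrite mem_cat inE mem_cat !mem_nseq; lia.
rewrite size_hooks_cat /= !size_hooks_cat !size_hooks_nseq /= !count_cat !count_nseq /=.
rewrite [RHS](divn_eq r B). nia.
Qed.

(** * Characters of equal degree *)

Lemma mcoeff_alternant_diag (k : nat) (R : comNzRingType) (X : 'I_k -> nat) :
  injective X -> (alternant R X)@_[multinom X i | i < k] = 1.
Proof.
move=> injX; rewrite alternantE raddf_sum (bigD1 1%g) //= big1 => [|s ne_s1].
  rewrite odd_perm1 expr0 mul1r mcoeffX addr0.
  rewrite (_ : [multinom X ((1%g : 'S_k) i) | i < k] = [multinom X i | i < k]) ?eqxx //.
  by apply/mnmP=> i; rewrite !mnmE perm1.
rewrite mulr_sign; case: ifP => _; rewrite ?mcoeffN mcoeffX.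
all: case: eqP => [/mnmP eqX | _]; rewrite ?oppr0 //.
all: case/eqP: ne_s1; apply/permP=> i; rewrite perm1; apply: injX.
all: by have := eqX i; rewrite !mnmE.
Qed.

Lemma mcoeff_alternant_off (k : nat) (R : comNzRingType) (X Y : 'I_k -> nat) :
  (forall s : 'S_k, ~ X =1 Y \o s) -> (alternant R Y)@_[multinom X i | i < k] = 0.
Proof.
move=> neXY; rewrite alternantE raddf_sum big1 //= => s _.
rewrite mulr_sign; case: ifP => _; rewrite ?mcoeffN mcoeffX.
all: case: eqP => [/mnmP eqX | _]; rewrite ?oppr0 //.
all: by case: (neXY s) => i; have := eqX i; rewrite !mnmE.
Qed.

(** The words give orthonormal virtual characters, hence distinct irreducible ones up to sign, with
    degrees determined by the hook lengths. *)
Lemma max_equal_degree_words (n L k : nat) (I : finType) (w : I -> bitseq) :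
    injective w -> (forall u, size (w u) = L) -> (forall u, count id (w u) = k) ->
    (forall u, size (hooks (w u)) = n) ->
    (forall u v, perm_eq (hooks (w u)) (hooks (w v))) ->
  (#|I| <= max_equal_degree n)%N.
Proof.
move=> injw szw cntw szh permh; pose X u (i : 'I_k) := nth 0%N (beta (w u)) i.
have sz u : size (beta (w u)) = k by rewrite size_beta.
have sumX u : (\sum_i X u i = n + \sum_(i < k) i)%N.
  have := sum_beta (w u); rewrite szh cntw => <-.
  by rewrite (big_nth 0%N) big_mkord sz.
have injX u : injective (X u).
  move=> i j /eqP; rewrite nth_uniq ?sz //; first by move/eqP/val_inj.
  by rewrite (sorted_uniq ltn_trans ltnn) // beta_sorted.
have neX u v : u != v -> forall s : 'S_k, ~ X u =1 X v \o s.
  move=> ne_uv s eqX; case/eqP: ne_uv; apply: injw.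
  have eq_beta : beta (w u) =i beta (w v).
    move=> x; apply/(nthP 0%N)/(nthP 0%N) => -[i]; rewrite sz => lt_ik <-.
      by exists (s (Ordinal lt_ik)); [rewrite sz | exact: esym (eqX (Ordinal lt_ik))].
    exists (s^-1%g (Ordinal lt_ik)); first by rewrite sz.
    by have := eqX (s^-1%g (Ordinal lt_ik)); rewrite /= permKV.
  apply: (@eq_from_nth _ false) => [|i _]; first by rewrite !szw.
  by rewrite -!mem_beta eq_beta.
have /fin_all_exists2[chi Zchi chiE] u := frobenius_vchar n (X u).
have dot u v : '[chi u, chi v] = (u == v)%:R.
  rewrite (frobenius_dot (chiE u) (chiE v) (sumX v)).
  have [-> | ne_uv] := eqVneq u v; first exact: mcoeff_alternant_diag.
  by rewrite mcoeff_alternant_off //; apply: neX.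
(* The hook length formula, obtained by cancelling the product of differences. *)
have deg u : chi u 1%g * (\prod_(h <- hooks (w u)) h)%:R = n`!%:R.
  have := frobenius_degree (chiE u) (sumX u).
  have -> : \prod_i (X u i)`!%:R = (\prod_(x <- beta (w u)) x`!)%:R :> algC.
    by rewrite -natr_prod (big_nth 0%N) big_mkord sz.
  have -> : \prod_(i < k) \prod_(j < k | (i < j)%N) ((X u j)%:R - (X u i)%:R)
      = (diff_prod (beta (w u)))%:R :> algC.
    rewrite diff_prodE ?beta_sorted // sz natr_prod; apply: eq_bigr => i _.
    rewrite natr_prod; apply: eq_bigr => j lt_ij; rewrite natrB // ltnW //.
    by rewrite /X (sorted_ltn_nth ltn_trans 0%N (beta_sorted (w u))) // inE sz.
  rewrite hook_formula natrM mulrA; apply: mulIf; rewrite pnatr_eq0.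
  have : (\prod_(x <- beta (w u)) x`! != 0)%N.
    by rewrite -lt0n prodn_gt0 // => x; apply: fact_gt0.
  by rewrite hook_formula muln_eq0 negb_or => /andP[].
have /fin_all_exists[r rE] u : exists r : bool * Iirr [set: 'S_n], chi u = (-1) ^+ r.1 *: 'chi_r.2.
  have [|b [i def_chi]] := vchar_norm1P (Zchi u); first by rewrite dot eqxx.
  by exists (b, i).
have injr : injective (fun u => (r u).2).
  (* With equal indices the scalar product is a sign, hence nonzero, so [dot] forces u = v. *)
  move=> u v eq_r; apply/eqP; have := dot u v; rewrite !rE eq_r cfdotZl cfdotZr.
  rewrite cfdot_irr eqxx mulr1 rmorph_sign -signr_addb.
  by case: eqP => // _ /eqP; rewrite signr_eq0.
have eqA : equal_degree [set (r u).2 | u : I].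
  apply/forall_inP=> _ /imsetP[u _ ->]; apply/forall_inP=> _ /imsetP[v _ ->].
  (* Irreducible degrees are nonnegative, so absolute values remove the unknown signs. *)
  have nrm z : 'chi_(r z).2 1%g = `|chi z 1%g|.
    by rewrite rE cfunE normrMsign ger0_norm // char1_ge0 ?irr_char.
  rewrite !nrm; apply/eqP; congr `|_|.
  apply: (mulIf (_ : (\prod_(h <- hooks (w u)) h)%:R != 0)); last first.
    by rewrite deg (perm_big _ (permh u v)) deg.
  by apply/eqP=> h0; have /eqP := deg u; rewrite h0 mulr0 eq_sym pnatr_eq0 eqn0Ngt fact_gt0.
by rewrite -(card_imset _ injr); apply: (leq_bigmax_cond _ eqA).
Qed.

(** Towers of height m + 1 give 2^(m + 1) words. [M] is taken largest with K M^2 <= n, so that the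
    remainder r = n - K M^2 is less than K (2 M + 1). *)
Lemma max_equal_degree_unbounded m : exists n0, forall n, (n0 <= n)%N ->
  (m <= max_equal_degree n)%N.
Proof.
pose K := (\sum_(i < m.+1) 2 * 25 ^ i)%N.
have K0 : (0 < K)%N by rewrite /K big_ord_recl.
(* This threshold forces 8 K + 3 <= M; then r / (4 K) < M - 4 K, as [word_with_hooks] requires for
   [B] equal to 4 K. *)
exists (K * (8 * K + 3) ^ 2)%N => n le_n.
have [M ltnM leMn] : exists2 M, (n < K * M.+1 ^ 2)%N & (K * M ^ 2 <= n)%N.
  have exM : exists M, (n < K * M.+1 ^ 2)%N by exists n; rewrite -mulnn; nia.
  have [[|M] ltM minM] := ex_minnP exM; first by exists 0%N; rewrite ?muln0.
  by exists M.+1 => //; rewrite leqNgt; apply/negP=> /minM; rewrite ltnn.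
have leKM : (8 * K + 3 <= M)%N.
  by have := leq_ltn_trans le_n ltnM; rewrite ltn_pmul2l // ltn_exp2r.
have [||w [sz_w wf hk_w]] := @word_with_hooks (4 * K) M (n - K * M ^ 2).
- by rewrite muln_gt0.
- have : ((n - K * M ^ 2) %/ (4 * K) < M - 4 * K)%N.
    by rewrite ltn_divLR ?muln_gt0 // -!mulnn in ltnM leMn *; nia.
  by lia.
pose W (bs : m.+1.-tuple bool) := tower w bs.
have szW bs : size (W bs) = (5 ^ m.+1 * M)%N by rewrite size_tower size_tuple sz_w.
pose bs0 := [tuple of nseq m.+1 true].
apply: leq_trans (max_equal_degree_words (w := W) (k := count id (W bs0)) _ szW _ _ _).
- by rewrite card_tuple card_bool ltnW // (ltn_trans (ltnSn m)) // ltn_expl.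
- by move=> bs bs' /tower_inj eq_bs; apply/val_inj/eq_bs; rewrite ?size_tuple.
- by move=> bs; apply: count_tower; rewrite !size_tuple.
- move=> bs; rewrite size_hooks_tower size_tuple hk_w sz_w -/K.
  by rewrite [(M ^ 2 * K)%N]mulnC subnK.
by move=> bs bs'; apply: perm_hooks_tower; rewrite !size_tuple.
Qed.

From mathcomp Require Import classical_sets filter.
Local Open Scope classical_set_scope.

Theorem theorem1p2 : max_equal_degree @ \oo --> \oo.
Proof.
(* A neighborhood of infinity contains all naturals from some [N] on. *)
move=> P [N _ NP]; have [n0 n0P] := max_equal_degree_unbounded N.
exists n0 => // n /= le_n0n; apply: NP => /=.
exact: n0P.
Qed.
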